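(* Let $A\in\mathbb{R}^{n\times n}$ be passive, $B\in\mathbb{R}^{n\times q}$, $C\in\mathbb{R}^{1\times n}$. Let $V_k\in\mathbb{R}^{n\times k}$ have orthonormal columns spanning the rational Krylov subspace $\mathcal{K}_k$ generated by $A^*$ and $C^*$ (with $C^*\in\mathcal{K}_k$), and let $T_k=V_k^*AV_k$, $B_k=V_k^*B$, $C_k=CV_k$. Let $\hat v_{k+1}\in\mathbb{R}^n$ and $g_k\in\mathbb{R}^k$ be the vectors in the Arnoldi relation $$A^*V_k=V_kT_k^*+\hat v_{k+1}g_k^*,$$ where $[V_k,\hat v_{k+1}]$ has orthonormal columns. Let $Y_k\ge0$ be the stabilizing solution of $T_k^*Y+YT_k-YB_kB_k^*Y+C_k^*C_k=0$, and let $X_k=V_kY_kV_k^*$. Then $X=X_k$ satisfies the algebraic Riccati equation $$(A^*-\hat v_{k+1}f_k^* )X+X(A-f_k\hat v_{k+1}^* )-XBB^*X+C^*C=0,\qquad f_k=V_kg_k.$$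
   Context: $M^*$ denotes the conjugate transpose. $Y\ge0$ means symmetric positive semidefinite. A matrix is stable if all its eigenvalues lie in the open left half complex plane; $A$ is passive if its field of values $\{x^*Ax/(x^*x): 0\ne x\in\mathbb{C}^n\}$ lies in the open left half plane. If $A$ is passive then $T_k$ is stable and the reduced Riccati equation has a unique positive semidefinite solution $Y_k$ that is stabilizing, i.e. such that $T_k-B_kB_k^*Y_k$ is stable. For shifts $s_2,\dots,s_k$ with positive real part (closed under conjugation), the rational Krylov subspace is $\mathcal{K}_k=\mathrm{range}([C^*,(A^*-s_2I)^{-1}C^*,\dots,\prod_{j=1}^{k-1}(A^*-s_{j+1}I)^{-1}C^*])$, assumed of dimension $k$; an orthonormal basis of it satisfies an Arnoldi relation of the displayed form. *)

(* Defs.v *)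
From HB Require Import structures.
From mathcomp Require Import all_boot all_order all_algebra spectral.
From mathcomp Require Import complex.
From mathcomp Require Import classical_sets reals.

Set Implicit Arguments.
Unset Strict Implicit.
Unset Printing Implicit Defensive.
Import Order.TTheory GRing.Theory Num.Theory.
Local Open Scope classical_set_scope.
Local Open Scope ring_scope.
Local Open Scope complex_scope.
Local Open Scope sesquilinear_scope.

Definition toC (R : realType) m n (M : 'M[R]_(m, n)) : 'M[R[i]]_(m, n) :=
  map_mx (real_complex R) M.

Definition stable (R : realType) n (M : 'M[R]_n) : Prop :=
  forall l : R[i], eigenvalue (toC M) l -> complex.Re l < 0.

(* [x ^t*] is the conjugate transpose, and [_ 0 0] reads a 1 x 1 matrix as a
   scalar. *)
Definition field_of_values (R : realType) n (M : 'M[R[i]]_n) : set R[i] :=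
  [set (x ^t* *m M *m x) 0 0 / (x ^t* *m x) 0 0
     | x in [set x : 'cV[R[i]]_n | x != 0]].

Definition passive (R : realType) n (A : 'M[R]_n) : Prop :=
  field_of_values (toC A) `<=` [set w | complex.Re w < 0].

Definition psd (R : realType) n (Y : 'M[R]_n) : Prop :=
  Y^T = Y /\ forall x : 'cV[R]_n, 0 <= (x^T *m Y *m x) 0 0.

Definition orthonormal_cols (R : realType) m n (V : 'M[R]_(m, n)) : Prop :=
  V^T *m V = 1%:M.

(* With [s = [:: s_2; ...; s_k]], column [j] (counted from 0) is
   (M - s_2 I)^-1 ... (M - s_(j+1) I)^-1 b; the order of the factors is
   immaterial since they commute. *)
Definition rat_krylov_mx (F : fieldType) n (M : 'M[F]_n) (b : 'cV[F]_n)
    (s : seq F) : 'M[F]_(n, (size s).+1) :=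
  \matrix_(i, j) ((\prod_(z <- take j s) invmx (M - z%:M)) *m b) i 0.

(* The range of the complex matrix [K] is the complex span of the columns of
   the real matrix [V]; [%MS] compares row spaces, hence the transposes. *)
Definition cols_span (R : realType) n k l
    (V : 'M[R]_(n, k)) (K : 'M[R[i]]_(n, l)) : Prop :=
  ((toC V)^T == K^T)%MS.

(* Main.v *)
(** With [V] having orthonormal columns, [V V^T C^T = C^T] because [C^T] is the
    first rational Krylov vector. Multiplying the Arnoldi relation by [Y V^T],
    the rank-one correction [v f^T] removes exactly the residual term, so that
    the left-hand side collapses to [V (reduced Riccati residual) V^T = 0]. *)

Require Import Defs.
From HB Require Import structures.
From mathcomp Require Import all_boot all_order all_algebra.
From mathcomp Require Import complex.
From mathcomp Require Import classical_sets reals.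

Set Implicit Arguments.
Unset Strict Implicit.
Unset Printing Implicit Defensive.
Import Order.TTheory GRing.Theory Num.Theory.
Local Open Scope ring_scope.
Local Open Scope complex_scope.

Lemma col0_rat_krylov_mx (F : fieldType) n (M : 'M[F]_n) (b : 'cV[F]_n)
    (s : seq F) : col ord0 (rat_krylov_mx M b s) = b.
Proof.
apply/matrixP => i j; rewrite 2!mxE take0 big_nil (ord1 j).
(* The empty product is the ring unit, equal to [1%:M] by conversion. *)
exact: (congr1 (fun N : 'cV_n => N i 0) (mul1mx b)).
Qed.

(** The coordinates [w] of [b] in the columns of [V] are a priori complex. Over [R[i]], [V^T V = 1]
    gives [V V^T (V w) = V w], and the identity descends to [R] because the embedding is
    injective. *)
Lemma cols_span_proj (R : realType) n k l (V : 'M[R]_(n, k))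
    (K : 'M[R[i]]_(n, l)) (b : 'cV[R]_n) (j : 'I_l) :
  orthonormal_cols V -> cols_span V K -> col j K = toC b ->
  V *m (V^T *m b) = b.
Proof.
move=> hV /andP[_ sKV] Kb.
have /submxP[w hw] : ((toC b)^T <= (toC V)^T)%MS.
  by rewrite -Kb tr_col; apply: submx_trans sKV; apply: row_sub.
have bVw : toC b = toC V *m w^T by rewrite -[LHS]trmxK hw trmx_mul trmxK.
have VtV : toC V^T *m toC V = 1%:M by rewrite -map_mxM hV map_mx1.
apply: (@map_mx_inj _ _ (real_complex R)).
rewrite 2!map_mxM [map_mx _ b]bVw [map_mx _ V^T *m _]mulmxA.
by rewrite [map_mx _ V^T *m _]VtV mul1mx.
Qed.

Theorem proposition5p1 (R : realType) (n q k : nat)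
    (A : 'M[R]_n) (B : 'M[R]_(n, q)) (C : 'rV[R]_n)
    (hA : passive A)
    (s : seq R[i])
    (hk : k = (size s).+1)
    (hs_pos : forall z : R[i], z \in s -> 0 < complex.Re z)
    (hs_conj : perm_eq [seq z^* | z <- s] s)
    (hdim : \rank (rat_krylov_mx (toC A^T) (toC C^T) s) = k)
    (V : 'M[R]_(n, k))
    (hV : orthonormal_cols V)
    (hVspan : cols_span V (rat_krylov_mx (toC A^T) (toC C^T) s))
    (T : 'M[R]_k) (hT : T = V^T *m A *m V)
    (Bk : 'M[R]_(k, q)) (hBk : Bk = V^T *m B)
    (Ck : 'rV[R]_k) (hCk : Ck = C *m V)
    (v : 'cV[R]_n) (g : 'cV[R]_k)
    (hVv : orthonormal_cols (row_mx V v))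
    (harnoldi : A^T *m V = V *m T^T + v *m g^T)
    (Y : 'M[R]_k)
    (hY_psd : psd Y)
    (hY_riccati :
       T^T *m Y + Y *m T - Y *m Bk *m Bk^T *m Y + Ck^T *m Ck = 0)
    (hY_stab : stable (T - Bk *m Bk^T *m Y))
    (X : 'M[R]_n) (hX : X = V *m Y *m V^T)
    (f : 'cV[R]_n) (hf : f = V *m g) :
  (A^T - v *m f^T) *m X + X *m (A - f *m v^T)
    - X *m B *m B^T *m X + C^T *m C = 0.
Proof.
have C_proj : C^T = V *m Ck^T.
  subst k; rewrite hCk trmx_mul.
  exact/esym/(cols_span_proj hV hVspan)/col0_rat_krylov_mx.
have Ct_proj : C = Ck *m V^T by rewrite -[LHS]trmxK C_proj trmx_mul trmxK.
(* The Arnoldi residual contributes [v g^T Y V^T]; this is [v f^T X], since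
   [f^T V = g^T V^T V = g^T]. *)
have left_term : (A^T - v *m f^T) *m X = V *m (T^T *m Y) *m V^T.
  rewrite hX hf trmx_mul mulmxBl !mulmxA harnoldi -(mulmxA _ V^T V) hV mulmx1.
  by rewrite !mulmxDl addrK.
(* The transposed Arnoldi relation, for the term with [A] to the right of [X]. *)
have VtA : V^T *m A = T *m V^T + g *m v^T.
  by rewrite -[LHS]trmxK trmx_mul trmxK harnoldi linearD /= !trmx_mul !trmxK.
have right_term : X *m (A - f *m v^T) = V *m (Y *m T) *m V^T.
  rewrite hX hf mulmxBr !mulmxA -(mulmxA _ V^T A) VtA -(mulmxA _ V^T V) hV.
  by rewrite mulmx1 mulmxDr !mulmxA addrK.
have quad_term : X *m B *m B^T *m X = V *m (Y *m Bk *m Bk^T *m Y) *m V^T.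
  by rewrite hX hBk trmx_mul trmxK !mulmxA.
rewrite left_term right_term quad_term C_proj {1}Ct_proj.
(* Zero is written as [V 0 V^T] with the reduced residual as inner zero, so both sides agree once
   expanded. *)
rewrite -[RHS](mul0mx _ V^T) -(mulmx0 _ V) -hY_riccati.
by rewrite !(mulmxDl, mulmxDr, mulmxN, mulNmx) !mulmxA.
Qed.
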